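(* There exists a constant $c$ such that the following holds for all natural numbers $d$, $r$ and $n$ satisfying $n \ge 2^{d^2 2^{cr}}$. For every edge two-coloring of the complete graph on at least $2^{d2^{cr}}n$ vertices, one of the colors is universal for the family of $d$-degenerate $r$-colorable graphs on at most $n$ vertices.
   Context: A graph is $d$-degenerate if every subgraph of it has a vertex of degree at most $d$. A graph is $r$-colorable if it admits a proper vertex coloring with $r$ colors. A graph $G$ is universal for a family $\mathcal{F}$ of graphs if it contains every $F \in \mathcal{F}$ as a (not necessarily induced) subgraph. In an edge coloring, a color is universal for $\mathcal{F}$ if the graph formed by the edges of that color (on the whole vertex set) is universal for $\mathcal{F}$. *)

(* Defs.v *)
From HB Require Import structures.
From mathcomp Require Import all_boot.

Set Implicit Arguments.
Unset Strict Implicit.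
Unset Printing Implicit Defensive.

Record sgraph := SGraph {
  vertex :> finType;
  adj : rel vertex;
  adj_sym : symmetric adj;
  adj_irrefl : irreflexive adj
}.

Definition degree (G : sgraph) (x : G) : nat := #|[set y : G | adj x y]|.

(* [F] is isomorphic to a (not necessarily induced) subgraph of [G]. *)
Definition contains (G F : sgraph) : Prop :=
  exists f : F -> G, injective f /\ forall x y : F, adj x y -> adj (f x) (f y).

(* The empty subgraph has no vertex at all and must be excluded. *)
Definition degenerate (d : nat) (G : sgraph) : Prop :=
  forall H : sgraph, 0 < #|H| -> contains G H -> exists x : H, degree x <= d.

Definition colorable (r : nat) (G : sgraph) : Prop :=
  exists k : G -> 'I_r, forall x y : G, adj x y -> k x != k y.

Definition universal (G : sgraph) (family : sgraph -> Prop) : Prop :=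
  forall F : sgraph, family F -> contains G F.

Definition degenerate_colorable_family (d r n : nat) (F : sgraph) : Prop :=
  [/\ degenerate d F, colorable r F & #|F| <= n].

Section CompleteGraph.
Variable V : finType.

Definition complete_adj : rel V := fun x y => x != y.

Lemma complete_adj_sym : symmetric complete_adj.
Proof. by move=> x y; rewrite /complete_adj eq_sym. Qed.

Lemma complete_adj_irrefl : irreflexive complete_adj.
Proof. by move=> x; rewrite /complete_adj eqxx. Qed.

Definition complete_graph : sgraph :=
  SGraph complete_adj_sym complete_adj_irrefl.

End CompleteGraph.

(* An edge two-coloring of [G] is a map [chi : {set G} -> bool]; only its
   values on the edges [[set x; y]] with [adj x y] are ever used. *)
Section ColorGraph.
Variables (G : sgraph) (chi : {set G} -> bool) (b : bool).

Definition color_adj : rel G := fun x y => adj x y && (chi [set x; y] == b).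

Lemma color_adj_sym : symmetric color_adj.
Proof. by move=> x y; rewrite /color_adj adj_sym setUC. Qed.

Lemma color_adj_irrefl : irreflexive color_adj.
Proof. by move=> x; rewrite /color_adj adj_irrefl. Qed.

Definition color_graph : sgraph := SGraph color_adj_sym color_adj_irrefl.

End ColorGraph.

(* Main.v *)
(* Let N = |V|.  Dependent random choice along a chain of nested sets, using 2r
   random tuples of geometrically decreasing lengths, each drawn from the common
   neighbourhood, in a majority colour, of its predecessor, gives (by pigeonhole on
   the colours) one colour and sets V_1, ..., V_r such that, for each j, the 2d-th
   moment of N / (1 + |N(Q) :&: V_j|) over the tuples Q of at most d vertices from
   the other sets is at most 2^(O(d^2 4^r)).

   A d-degenerate r-partite graph is then embedded one vertex at a time, the
   image of v being an unused common neighbour, in the part of v, of the images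
   of its earlier neighbours.  If a candidates are left for v, put X_v = N / a.
   For a vertex u still to be embedded, consider the mean of
   N^k / ((a + 1) ... (a + k)) over all completions of the images of its earlier
   neighbours, where k = 2d and a counts the unused candidates.  Embedding an
   earlier neighbour w of u multiplies this mean by at most X_w on average;
   embedding any other vertex s, which may use up a candidate, by at most
   1 + k X_s / N.  Dividing by these factors gives a potential that some choice
   does not increase, so no candidate set ever becomes empty.  The only global
   input is a bound on the sum of the X_s.  It follows because X_u^k is at most a
   constant times the potential of u times the product of the X_w over its earlier
   neighbours w, once the vertices get weights om with
   om u = 1 + (1/2d) * (sum of om v over the later neighbours v of u). *)
Require Import Defs.
From HB Require Import structures.
From mathcomp Require Import all_boot all_order all_algebra.
From mathcomp Require Import ring lra zify.

Set Implicit Arguments.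
Unset Strict Implicit.
Unset Printing Implicit Defensive.

Import Order.TTheory GRing.Theory Num.Theory.
Local Open Scope ring_scope.

(** * Sums over tuples of vertices *)

Section TupleSum.
Variable V : finType.
Implicit Types (A B : {set V}) (m : nat) (g h : seq V -> rat) (l : seq V).

(** An unnormalised expectation over a random [m]-tuple. With lists, splitting a tuple into
    consecutive blocks is mere concatenation. *)
Fixpoint tsum A m g : rat :=
  if m is m'.+1 then \sum_(x in A) tsum A m' (fun l => g (x :: l)) else g [::].

Lemma tsum_cat A a b g :
  tsum A (a + b) g = tsum A a (fun l => tsum A b (fun l' => g (l ++ l'))).
Proof. by elim: a g => //= a IH g; apply: eq_bigr => x _; rewrite IH. Qed.

Lemma ler_tsum A m g h :
  (forall l, all [in A] l -> g l <= h l) -> tsum A m g <= tsum A m h.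
Proof.
elim: m g h => [|m IH] g h le_gh /=; first exact: le_gh.
by apply: ler_sum => x xA; apply: IH => l lA; apply: le_gh; rewrite /= xA.
Qed.

Lemma eq_tsum A m g h :
  (forall l, all [in A] l -> g l = h l) -> tsum A m g = tsum A m h.
Proof. by move=> eq_gh; apply/le_anti/andP; split; apply: ler_tsum => l /eq_gh ->. Qed.

Lemma tsum_ge0 A m g : (forall l, 0 <= g l) -> 0 <= tsum A m g.
Proof. by elim: m g => //= m IH g g0; apply: sumr_ge0 => x _; apply: IH. Qed.

Lemma tsum_subset A B m g :
  A \subset B -> (forall l, 0 <= g l) -> tsum A m g <= tsum B m g.
Proof.
move=> sAB; elim: m g => //= m IH g g0.
rewrite [leRHS](big_setID A) /= (setIidPr sAB) -[leLHS]addr0.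
by apply: lerD; [apply: ler_sum => x _; apply: IH | apply: sumr_ge0 => x _; apply: tsum_ge0].
Qed.

Lemma tsum_const A m a : tsum A m (fun=> a) = #|A|%:R ^+ m * a.
Proof.
elim: m => [|m IH] /=; first by rewrite mul1r.
by rewrite sumr_const IH -[LHS]mulr_natl exprS mulrA.
Qed.

Lemma tsumZ A m a g : tsum A m (fun l => a * g l) = a * tsum A m g.
Proof.
by elim: m g => //= m IH g; rewrite mulr_sumr; apply: eq_bigr => x _; rewrite IH.
Qed.

Lemma tsum_sum (I : finType) (P : pred I) A m (g : I -> seq V -> rat) :
  tsum A m (fun l => \sum_(i | P i) g i l) = \sum_(i | P i) tsum A m (g i).
Proof.
elim: m g => //= m IH g; rewrite exchange_big /=.
by apply: eq_bigr => x _; rewrite IH.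
Qed.

Lemma tsumD A m g h : tsum A m (fun l => g l + h l) = tsum A m g + tsum A m h.
Proof. by elim: m g h => //= m IH g h; rewrite -big_split; apply: eq_bigr => x _; rewrite IH. Qed.

Lemma exchange_tsum A B a b (g : seq V -> seq V -> rat) :
  tsum A a (fun l => tsum B b (g l)) = tsum B b (fun l' => tsum A a (g^~ l')).
Proof.
elim: a g => //= a IH g; rewrite tsum_sum.
by apply: eq_bigr => x _; rewrite IH.
Qed.

Lemma tsum_setI A B m g :
  tsum (A :&: B) m g = tsum A m (fun l => if all [in B] l then g l else 0).
Proof.
elim: m g => //= m IH g.
rewrite [RHS](big_setID B) /= [X in _ = _ + X]big1 ?addr0.
  by apply: eq_bigr => x; rewrite inE => /andP[_ xB]; rewrite IH xB.
move=> x /setDP[_ /negPf xB]; rewrite xB /= -[RHS](mulr0 (#|A|%:R ^+ m)).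
exact: tsum_const.
Qed.

Lemma tsum_all A m (p : pred V) :
  tsum A m (fun l => (all p l)%:R) = #|[set x in A | p x]|%:R ^+ m.
Proof.
have -> : [set x in A | p x] = A :&: [set x | p x] by apply/setP=> x; rewrite !inE.
rewrite -[RHS]mulr1 -tsum_const tsum_setI; apply: eq_tsum => l _.
have -> : all [in [set x | p x]] l = all p l by apply: eq_all => x; rewrite /= inE.
by case: all.
Qed.

Lemma tsum_gt0_ex A m g :
  0 < tsum A m g -> exists l, [/\ size l = m, all [in A] l & 0 < g l].
Proof.
elim: m g => [|m IH] g /=; first by exists [::].
move=> gt0.
have [/existsP[x /andP[xA /IH[l [sl lA gl]]]] | none] :=
    boolP [exists x in A, 0 < tsum A m (fun l => g (x :: l))].
  by exists (x :: l); rewrite /= sl xA.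
move: gt0; rewrite ltNge sumr_le0 // => x xA.
rewrite leNgt; apply: contra none => gt0.
by apply/existsP; exists x; rewrite xA.
Qed.

End TupleSum.

(** * A smoothed inverse power of a number of candidates *)

Section Weight.
Variable k : nat.

(* Unlike [a^-k], this is finite at [a = 0], and the loss of one candidate costs
   exactly [wt a.-1 - wt a = (k / a) * wt a]. *)
Definition wt (a : nat) : rat := a`!%:R / (a + k)`!%:R.

Lemma fact_neq0 (a : nat) : (a`!%:R : rat) != 0.
Proof. by rewrite pnatr_eq0 -lt0n fact_gt0. Qed.

Lemma wt_gt0 a : 0 < wt a.
Proof. by rewrite divr_gt0 // ltr0n fact_gt0. Qed.

Lemma wt_ge0 a : 0 <= wt a.
Proof. exact/ltW/wt_gt0. Qed.

Lemma wtS a : a.+1%:R * wt a = (a.+1 + k)%:R * wt a.+1.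
Proof.
rewrite /wt addSn !factS !natrM.
have : ((a + k).+1%:R : rat) != 0 by rewrite pnatr_eq0.
have := fact_neq0 (a + k).
by move: (_`!%:R) (_.+1%:R) (_.+1%:R) => x y z x0 z0; field; apply/andP.
Qed.

Lemma wt_anti a b : (a <= b)%N -> wt b <= wt a.
Proof.
elim: b => [|b IH]; first by rewrite leqn0 => /eqP->.
rewrite leq_eqVlt => /predU1P[-> //|/IH]; apply: le_trans.
rewrite -(ler_pM2l (ltr0Sn rat b)) wtS ler_wpM2r ?wt_ge0 //.
by rewrite ler_nat leq_addr.
Qed.

Lemma leq_exp2rW a b j : (a <= b)%N -> (a ^ j <= b ^ j)%N.
Proof. by case: j => // j; rewrite leq_exp2r. Qed.

Lemma fact_lb a : (a`! * a.+1 ^ k <= (a + k)`!)%N.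
Proof.
elim: k => [|j IH]; first by rewrite muln1 addn0.
by rewrite addnS factS expnSr mulnA [leqRHS]mulnC leq_mul // ltnS leq_addr.
Qed.

Lemma fact_ub a : ((a + k)`! <= a`! * (a + k) ^ k)%N.
Proof.
elim: k => [|j IH]; first by rewrite muln1 addn0.
rewrite addnS factS expnS mulnCA leq_mul //.
by apply: leq_trans IH _; rewrite leq_mul // leq_exp2rW // leqnSn.
Qed.

Lemma wt_le a : wt a <= a.+1%:R^-1 ^+ k.
Proof.
rewrite exprVn -natrX ler_pdivrMr ?ltr0n ?fact_gt0 // mulrC.
by rewrite ler_pdivlMr ?ltr0n ?expn_gt0 // -natrM ler_nat fact_lb.
Qed.

(** Each of the [k] factors of [(a + k)! / a!] is at most [a + k], hence at most [(k + 1) * a] when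
    [a > 0]. *)
Lemma wt_ge a : (0 < a)%N -> a%:R^-1 ^+ k <= k.+1%:R ^+ k * wt a.
Proof.
move=> a0; rewrite exprVn -ler_pdivrMl ?exprn_gt0 ?ltr0n //.
rewrite -!natrX -invfM -natrM -expnMn ler_pdivlMr ?ltr0n ?fact_gt0 // mulrC.
rewrite ler_pdivrMr ?ltr0n ?expn_gt0 ?muln_gt0 ?a0 // -natrM ler_nat.
apply: leq_trans (fact_ub a) _; rewrite leq_mul // leq_exp2rW //.
by rewrite mulSn leq_add2l leq_pmulr.
Qed.

(** Only the [z] in [A :&: C] change the weight, each by a factor [1 + k / #|C|]. There are at most
    [#|C|] of them, so the total excess is at most [k * wt #|C|]. *)
Lemma sum_wtD1 (V : finType) (A C : {set V}) :
  \sum_(z in A) wt #|C :\ z| <= (#|A| + k)%:R * wt #|C|.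
Proof.
have [->|[x xC]] := set_0Vmem C.
  under eq_bigr do rewrite set0D.
  rewrite sumr_const -[leLHS]mulr_natl ler_wpM2r ?wt_ge0 //.
  by rewrite ler_nat leq_addr.
have eqC : #|C| = #|C|.-1.+1 by rewrite prednK // (cardD1 x) xC.
rewrite (big_setID C) /=.
have -> : \sum_(z in A :&: C) wt #|C :\ z| = #|A :&: C|%:R * wt #|C|.-1.
  rewrite mulr_natl -sumr_const; apply: eq_bigr => z /setIP[_ zC].
  by congr wt; rewrite [in RHS](cardsD1 z) zC.
have -> : \sum_(z in A :\: C) wt #|C :\ z| = #|A :\: C|%:R * wt #|C|.
  rewrite mulr_natl -sumr_const; apply: eq_bigr => z /setDP[_ zC].
  by congr wt; apply: eq_card => y; rewrite !inE; case: eqP => // ->; rewrite (negPf zC).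
rewrite -(cardsID C A) addnAC natrD mulrDl lerD2r.
have le_w : wt #|C| <= wt #|C|.-1 by rewrite wt_anti ?leq_pred.
have := wtS #|C|.-1; rewrite -eqC natrD => eqw.
have le_AC : (#|A :&: C|%:R : rat) <= #|C|%:R by rewrite ler_nat subset_leq_card // subsetIr.
rewrite natrD; nra.
Qed.

End Weight.

(** * Vertex weights and the sum of the loads *)

Section Load.
Variables (F : finType) (W : F -> {set F}) (rank : F -> nat) (d : nat).
Hypothesis rankW : forall u w, w \in W u -> (rank w < rank u)%N.
Hypothesis cardW : forall u, (#|W u| <= d)%N.
Hypothesis d_gt0 : (0 < d)%N.

Let c : rat := (d.*2)%:R^-1.

Let d2_gt0 : 0 < (d.*2%:R : rat).
Proof. by rewrite ltr0n double_gt0. Qed.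

Let c_ge0 : 0 <= c.
Proof. by rewrite invr_ge0 ltW. Qed.

(** The recursion follows increasing ranks, so iterating it stabilises. Each [v] contributes
    [c * om v] to at most [d] vertices, hence the sum of [om] is at most [#|F|] plus half of
    itself. *)
Lemma load_exists : exists om : F -> rat,
  [/\ forall u, 1 <= om u,
      forall u, om u = 1 + c * \sum_(v | u \in W v) om v
    & \sum_u om u <= 2 * #|F|%:R].
Proof.
pose fix om t u {struct t} : rat :=
  if t is t'.+1 then 1 + c * \sum_(v | u \in W v) om t' v else 1.
have om_ge1 t u : 1 <= om t u.
  elim: t u => //= t IH u; rewrite lerDl mulr_ge0 //.
  by apply: sumr_ge0 => v _; apply: le_trans (IH v).
pose R := (\max_u rank u).+1.
have rankR u : (rank u < R)%N by rewrite ltnS leq_bigmax.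
(* A chain of later neighbours starting at [u] has fewer than [R - rank u] steps, so further
   iterations change nothing. *)
have stable t t' u : (R <= rank u + t -> R <= rank u + t' -> om t u = om t' u)%N.
  elim: t t' u => [|t IH] [|t'] u //=; rewrite ?addn0 1?leqNgt ?rankR //.
    by rewrite -leqNgt => _; rewrite leqNgt rankR.
  rewrite -leqNgt => le1 le2; congr (1 + c * _); apply: eq_bigr => v uv.
  by apply: IH; have := rankW uv; lia.
exists (om R); have omE u : om R u = 1 + c * \sum_(v | u \in W v) om R v.
  by rewrite (stable R R.+1) ?leq_addl //; apply: leq_trans (leqnSn _) (leq_addl _ _).
split=> //.
have : c * \sum_v om R v * #|W v|%:R <= 2^-1 * \sum_u om R u.
  rewrite /c -[leLHS]mulrC ler_pdivrMr // -muln2 natrM.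
  rewrite [leRHS](_ : _ = d%:R * \sum_u om R u); last by field.
  rewrite mulr_sumr; apply: ler_sum => v _; rewrite mulrC ler_wpM2r ?ler_nat //.
  exact: le_trans (om_ge1 _ _).
have: \sum_u om R u = #|F|%:R + c * \sum_v (om R v * #|W v|%:R).
  under eq_bigr do rewrite omE.
  rewrite big_split /= sumr_const -mulr_sumr; congr (_ + _ * _).
  rewrite (exchange_big_dep xpredT) //=; apply: eq_bigr => v _.
  by rewrite sumr_const mulr_natr.
by move=> eqS leS; lra.
Qed.

(* If the last sum does not already dominate [X u / K], then every [X w] is at
   most [2d * X u], and the hypothesis bounds [X u ^+ d]. *)
Lemma load_step (X : F -> rat) (K A : rat) (u : F) :
  1 <= K -> (forall w, w \in u |: W u -> 0 < X w) ->
  X u ^+ d.*2 <= A * \prod_(w in W u) X w ->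
  X u / K <= 1 + d.*2%:R ^+ d * A / K ^+ d + c * \sum_(w in W u) X w / K.
Proof.
move=> K1 X0 leX; have K0 : 0 < K by apply: lt_le_trans K1.
have Xu0 : 0 < X u by apply: X0; rewrite setU11.
have XW0 w : w \in W u -> 0 < X w by move=> wu; apply: X0; rewrite setU1r.
have prod0 : 0 < \prod_(w in W u) X w by apply: prodr_gt0.
have A0 : 0 <= A.
  rewrite -(pmulr_lge0 _ prod0); apply: le_trans leX; exact/exprn_ge0/ltW.
have sum0 : 0 <= c * \sum_(w in W u) X w / K.
  rewrite mulr_ge0 // sumr_ge0 // => w wu.
  by rewrite divr_ge0 ?ltW ?XW0.
have mid0 : 0 <= d.*2%:R ^+ d * A / K ^+ d.
  by rewrite divr_ge0 ?mulr_ge0 ?exprn_ge0 // ltW.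
have [le1|gt1] := leP (X u / K) 1; first by lra.
have [le2|gt2] := leP (X u / K) (c * \sum_(w in W u) X w / K); first by lra.
suff: X u / K <= d.*2%:R ^+ d * A / K ^+ d by lra.
have XuK : K < X u by move: gt1; rewrite ltr_pdivlMr // mul1r.
have leXw w : w \in W u -> X w <= d.*2%:R * X u.
  move=> wu; rewrite -(ler_pdivrMl _ _ d2_gt0) -(ler_pM2r (x := K^-1)) ?invr_gt0 //.
  apply: ltW; apply: le_lt_trans gt2; rewrite -/c -mulrA ler_wpM2l //.
  rewrite (bigD1 w) //= lerDl sumr_ge0 // => w' /andP[w'u _].
  by rewrite divr_ge0 ?ltW ?XW0.
have ge1 : 1 <= d.*2%:R * X u.
  have : (1 : rat) <= d.*2%:R by rewrite ler1n double_gt0.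
  by move=> ?; nra.
have le_prod : \prod_(w in W u) X w <= (d.*2%:R * X u) ^+ d.
  apply: le_trans (_ : _ <= (d.*2%:R * X u) ^+ #|W u|) _.
    rewrite -prodr_const; apply: ler_prod => w wu.
    by rewrite ltW ?XW0 //= leXw.
  exact: ler_weXn2l.
have le_d : X u ^+ d <= d.*2%:R ^+ d * A.
  rewrite -(ler_pM2r (exprn_gt0 d Xu0)) -exprD addnn.
  apply: le_trans leX _; apply: le_trans (ler_wpM2l A0 le_prod) _.
  by rewrite exprMn mulrA [A * _]mulrC.
apply: le_trans (_ : _ <= (X u / K) ^+ d) _.
  by apply: ler_eXnr => //; apply: ltW.
by rewrite expr_div_n ler_wpM2r ?invr_ge0 ?exprn_ge0 // ltW.
Qed.

(** [load_step] is summed with weights [om u]. The terms in [X w] caused by the later neighbours of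
    [w] add up to at most [(om w - 1) * X w / K], so each [X w / K] keeps coefficient 1; the
    remaining terms cost [2 * n] and [n]. *)
Lemma sum_load (om : F -> rat) (S : {set F}) (X al : F -> rat) (K M : rat) (n : nat) :
  (forall u, 1 <= om u) ->
  (forall u, om u = 1 + c * \sum_(v | u \in W v) om v) ->
  \sum_u om u <= 2 * n%:R ->
  (forall u, u \in S -> W u \subset S) ->
  (forall u, u \in S -> 0 < X u) ->
  (forall u, u \in S -> X u ^+ d.*2 <= M * al u * \prod_(w in W u) X w) ->
  1 <= K -> d.*2%:R ^+ d * M * \sum_(u in S) om u * al u <= n%:R * K ^+ d ->
  \sum_(u in S) X u <= 3 * n%:R * K.
Proof.
move=> om1 omE sum_om clS X0 leX K1 leM; have K0 : 0 < K by apply: lt_le_trans K1.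
have om0 u : 0 <= om u by apply: le_trans (om1 u).
have K0d : 0 < K ^+ d by apply: exprn_gt0.
rewrite -ler_pdivrMr // mulr_suml.
have step u : u \in S -> om u * (X u / K) <=
   om u * (1 + d.*2%:R ^+ d * (M * al u) / K ^+ d) + om u * (c * \sum_(w in W u) X w / K).
  move=> uS; rewrite -mulrDr; apply: ler_wpM2l => //; apply: load_step => //; last exact: leX.
  by move=> w /setU1P[->|wu]; apply: X0 => //; apply: subsetP (clS _ uS) w wu.
have := ler_sum (index_enum F) step; rewrite big_split /=.
set Y := fun w => X w / K.
have Y0 u : u \in S -> 0 <= Y u by move=> uS; rewrite divr_ge0 ?ltW // X0.
have key : \sum_(u in S) om u * (c * \sum_(w in W u) Y w) <=
           \sum_(w in S) (om w - 1) * Y w.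
  under eq_bigr do rewrite !mulr_sumr.
  rewrite (exchange_big_dep (mem S)) /=; last first.
    by move=> u w uS wu; apply: subsetP (clS _ uS) w wu.
  apply: ler_sum => w wS; rewrite omE addrAC subrr add0r mulr_sumr mulr_suml.
  rewrite big_mkcond [leRHS]big_mkcond; apply: ler_sum => u _ /=.
  have := mulr_ge0 (mulr_ge0 c_ge0 (om0 u)) (Y0 w wS).
  by case: (u \in S); case: (w \in W u) => //= _; rewrite mulrCA mulrA.
rewrite [X in _ <= X + _](_ : _ = \sum_(u in S) om u +
    d.*2%:R ^+ d * M * (\sum_(u in S) om u * al u) / K ^+ d); last first.
  rewrite mulr_sumr mulr_suml -big_split /=; apply: eq_bigr => u _.
  by field; rewrite gt_eqF.
have : \sum_(u in S) (om u * Y u) - \sum_(w in S) (om w - 1) * Y w = \sum_(u in S) Y u.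
  by rewrite -sumrB; apply: eq_bigr => u _; ring.
have : d.*2%:R ^+ d * M * (\sum_(u in S) om u * al u) / K ^+ d <= n%:R.
  by rewrite ler_pdivrMr.
have : \sum_(u in S) om u <= \sum_u om u.
  by rewrite [leRHS](bigID (mem S)) /= lerDl sumr_ge0.
by move: key; rewrite -/Y => *; lra.
Qed.

End Load.

(** * Embedding a degenerate graph vertex by vertex *)

Definition common_nbrs (V : finType) (e : rel V) (l : seq V) : {set V} :=
  [set x | all (e x) l].

(** A new factor is harmless because [(1 + y) * (1 - s - y) = 1 - s - y * (y + s)]. Once the sum is
    at most 1/2, this bounds the product by 2. *)
Lemma prod1D_le (I : finType) (P : pred I) (y : I -> rat) :
  (forall i, P i -> 0 <= y i) ->
  (\prod_(i | P i) (1 + y i)) * (1 - \sum_(i | P i) y i) <= 1.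
Proof.
move=> y0; pose R (p s : rat) := [/\ 0 <= s, 0 <= p & p * (1 - s) <= 1].
suff [] : R (\prod_(i | P i) (1 + y i)) (\sum_(i | P i) y i) by [].
apply: (big_rec2 R) => [|i p s Pi [s0 p0 ps]].
  by split; rewrite ?ler01 // subr0 mulr1.
have yi := y0 i Pi; split; [by lra | by nra |].
apply: le_trans ps; rewrite -subr_ge0.
rewrite [leRHS](_ : _ = p * (y i * (y i + s))); last by ring.
by rewrite !mulr_ge0 ?addr_ge0.
Qed.

Lemma exists_le_mean (T : finType) (A : {set T}) (g : T -> rat) (a : rat) :
  (0 < #|A|)%N -> \sum_(x in A) g x <= #|A|%:R * a -> exists2 x, x \in A & g x <= a.
Proof.
move=> A0 le_sum; apply/exists_inP; apply: contraT => /exists_inPn none.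
move: le_sum; rewrite mulr_natl -[leRHS]sumr_const leNgt => /negP[]; apply: ltr_sum.
  by have /card_gt0P[x xA] := A0; apply/hasP; exists x; rewrite ?mem_index_enum.
by move=> x xA; rewrite ltNge none.
Qed.

Section Embedding.
Variables (V : finType) (e : rel V) (F : finType) (W : F -> {set F}).
Variables (rank : F -> nat) (Vs Ms : F -> {set V}) (d n : nat) (beta K : rat).
Let N : rat := #|V|%:R.
Let k := d.*2.
Hypothesis e_irr : irreflexive e.
Hypothesis rankW : forall u w, w \in W u -> (rank w < rank u)%N.
Hypothesis cardW : forall u, (#|W u| <= d)%N.
Hypothesis d_gt0 : (0 < d)%N.
Hypothesis cardF : (#|F| <= n)%N.
Hypothesis VsMs : forall u w, w \in W u -> Vs w \subset Ms u.
Hypothesis sumMs : forall u m, (m <= d)%N ->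
  tsum (Ms u) m (fun l => (N / #|Vs u :&: common_nbrs e l|.+1%:R) ^+ k)
  <= N ^+ m * beta.
Hypothesis K_ge1 : 1 <= K.
Hypothesis leK : 4 * k%:R ^+ d * k.+1%:R ^+ k * beta <= K ^+ d.
Hypothesis leN : 12 * d%:R * n%:R * K <= N.
Hypothesis ltN : 4 * n%:R * beta * k`!%:R < N ^+ d.
Hypothesis N_ge1 : 1 <= N.
Hypothesis beta_ge0 : 0 <= beta.

Let N_gt0 : 0 < N. Proof. exact: lt_le_trans N_ge1. Qed.

Implicit Types (S : {set F}) (f : F -> V) (u v : F).

Definition upd (T : Type) (f : F -> T) (v : F) z := fun x => if x == v then z else f x.

Definition avail S f u : {set V} :=
  (Vs u :&: [set x | [forall w in W u :&: S, e x (f w)]]) :\: f @: S.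

(** A tuple stands for the images of the earlier neighbours not yet embedded. It is drawn from
    [Ms u] but normalised by powers of [N], so that embedding one of them costs [N] over the number
    of its candidates. *)
Definition phi S f u : rat :=
  N ^+ k / N ^+ #|W u :\: S| *
  tsum (Ms u) #|W u :\: S| (fun l => wt k #|avail S f u :&: common_nbrs e l|).

Lemma phi_ge0 S f u : 0 <= phi S f u.
Proof.
by rewrite mulr_ge0 ?divr_ge0 ?exprn_ge0 ?ler0n // tsum_ge0 // => l; apply: wt_ge0.
Qed.

Lemma imset_upd S (f : F -> V) v z : v \notin S -> upd f v z @: (v |: S) = z |: f @: S.
Proof.
move=> vS; rewrite imsetU1 /upd eqxx; congr (_ |: _); apply: eq_in_imset => x xS.
by case: eqP => // xv; rewrite -xv xS in vS.
Qed.

Lemma avail_upd S f v z u : v \notin S ->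
  avail (v |: S) (upd f v z) u =
  (avail S f u :&: [set x | (v \in W u) ==> e x z]) :\ z.
Proof.
move=> vS; rewrite /avail imset_upd //; apply/setP=> x; rewrite !inE negb_or.
have -> : [forall w in W u :&: (v |: S), e x (upd f v z w)] =
          [forall w in W u :&: S, e x (f w)] && ((v \in W u) ==> e x z).
  apply/forall_inP/andP => [all1 | [/forall_inP all1 /implyP all2] w].
    split; first apply/forall_inP => w /setIP[wu wS].
      have := all1 w; rewrite inE wu setU1r // /upd; case: eqP => [wv|_]; last exact.
      by rewrite -wv wS in vS.
    by apply/implyP => vu; have := all1 v; rewrite inE vu setU11 /upd eqxx; apply.
  case/setIP=> wu /setU1P[wv|wS]; rewrite /upd; first by rewrite wv eqxx all2 // -wv.
  case: eqP => [wv|_]; first by rewrite -wv wS in vS.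
  by rewrite all1 // inE wu.
by case: (x == z); case: (x \in f @: S); case: (x \in Vs u) => //=; rewrite ?andbF ?andbT.
Qed.

Lemma phi_step_other S f v u (A : {set V}) : v \notin S -> v \notin W u ->
  \sum_(z in A) phi (v |: S) (upd f v z) u <= (#|A| + k)%:R * phi S f u.
Proof.
move=> vS vu; rewrite /phi.
have -> : W u :\: (v |: S) = W u :\: S.
  by apply/setP=> x; rewrite !inE; case: eqP => //= ->; rewrite (negPf vu) andbF.
rewrite -mulr_sumr mulrCA ler_wpM2l ?divr_ge0 ?exprn_ge0 ?ler0n //.
rewrite -tsum_sum -tsumZ; apply: ler_tsum => l _.
apply: le_trans (sum_wtD1 k A _); apply: ler_sum => z _.
rewrite (_ : _ :&: _ = (avail S f u :&: common_nbrs e l) :\ z) //.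
rewrite avail_upd // (negPf vu) /=; apply/setP => x; rewrite !inE.
by rewrite andbT -!andbA.
Qed.

(** The chosen [z] takes the place of the first entry of the tuple in [phi S f u]; the factor [N]
    makes up for the normalisation of a shorter tuple. *)
Lemma phi_step_nbr S f v u (A : {set V}) : v \notin S -> v \in W u -> A \subset Ms u ->
  \sum_(z in A) phi (v |: S) (upd f v z) u <= N * phi S f u.
Proof.
move=> vS vu sA; rewrite /phi (cardsD1 v (W u :\: S)) inE vS vu /= add1n /=.
have -> : W u :\: S :\ v = W u :\: (v |: S).
  by apply/setP=> x; rewrite !inE negb_or; case: eqP.
set m := #|_|; rewrite -mulr_sumr.
set T := \sum_(i in Ms u) _.
have -> : N * (N ^+ k / N ^+ m.+1 * T) = N ^+ k / N ^+ m * T.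
  by rewrite exprS invfM !mulrA [N * _]mulrC mulfK ?gt_eqF.
rewrite /T ler_wpM2l ?divr_ge0 ?exprn_ge0 ?ler0n //.
rewrite [leRHS](big_setID A) /= (setIidPr sA) -[leLHS]addr0 lerD //; last first.
  by apply: sumr_ge0 => z _; apply: tsum_ge0 => l; apply: wt_ge0.
apply: ler_sum => z _; apply: ler_tsum => l _.
rewrite (_ : _ :&: _ = avail S f u :&: common_nbrs e (z :: l)) //.
rewrite avail_upd // vu /=; apply/setP=> x; rewrite !inE /=.
(* Using up [z] costs [u] no further candidate, since [z] is not adjacent to itself. *)
by case: eqP => [->|_] /=; rewrite ?e_irr ?andbF // !andbA.
Qed.

Variable om : F -> rat.
Hypothesis om_ge1 : forall u, 1 <= om u.
Hypothesis omE : forall u, om u = 1 + (d.*2)%:R^-1 * \sum_(v | u \in W v) om v.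
Hypothesis sum_om : \sum_u om u <= 2 * n%:R.

Let om_ge0 u : 0 <= om u. Proof. exact: le_trans (om_ge1 u). Qed.

Definition total_load (S : {set F}) (X : F -> rat) : rat :=
  \prod_(s in S) (1 + k%:R * X s / N).

Definition pending S f (X : F -> rat) u : rat :=
  phi S f u / (\prod_(w in W u :&: S) X w * total_load S X).

Record good S f (X al : F -> rat) : Prop := Good {
  good_closed : forall u, u \in S -> W u \subset S;
  good_inj : {in S &, injective f};
  good_adj : forall u w, u \in S -> w \in W u -> e (f u) (f w);
  good_X : forall u, u \in S -> 0 < X u <= N;
  good_al : forall u, u \in S ->
    X u ^+ k <= 2 * k.+1%:R ^+ k * al u * \prod_(w in W u) X w;
  good_pot : \sum_(u in S) om u * al u + \sum_(u in ~: S) om u * pending S f X u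
    <= 2 * n%:R * beta }.

Lemma good0 f : good set0 f (fun=> 1) (fun=> 0).
Proof.
split=> [u|u w|u w|u|u|]; rewrite ?inE // big_set0 add0r setC0.
apply: le_trans (_ : _ <= \sum_u om u * beta) _; last first.
  by rewrite -mulr_suml ler_wpM2r.
rewrite big_mkcond; apply: ler_sum => u _; rewrite inE ler_wpM2l //.
rewrite /pending setI0 /total_load !big_set0 mulr1 divr1 /phi setD0.
rewrite mulrAC ler_pdivrMr ?exprn_gt0 // [leRHS]mulrC -tsumZ.
apply: le_trans (sumMs u (cardW u)); apply: ler_tsum => l _.
rewrite expr_div_n ler_wpM2l ?exprn_ge0 ?ler0n // -exprVn.
suff -> : avail set0 f u = Vs u by apply: wt_le.
rewrite /avail imset0 setD0; apply/setIidPl/subsetP => x _; rewrite inE.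
by apply/forall_inP => w; rewrite setI0 inE.
Qed.

Section Good.
Variables (S : {set F}) (f : F -> V) (X al : F -> rat).
Hypothesis gd : good S f X al.

Lemma total_load_ge1 : 1 <= total_load S X.
Proof.
apply: (big_ind (>= 1)) => // [|s sS]; first exact: mulr_ege1.
have /andP[X0 _] := good_X gd sS.
by rewrite lerDl divr_ge0 ?ler0n // mulr_ge0 // ltW.
Qed.

Lemma prodX_gt0 u : 0 < \prod_(w in W u :&: S) X w.
Proof. by apply: prodr_gt0 => w /setIP[_ wS]; have /andP[] := good_X gd wS. Qed.

Lemma pending_ge0 u : 0 <= pending S f X u.
Proof.
rewrite divr_ge0 ?phi_ge0 // mulr_ge0 ?(ltW (prodX_gt0 _)) //.
exact: le_trans total_load_ge1.
Qed.

Lemma sum_X : \sum_(u in S) X u <= 3 * n%:R * K.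
Proof.
apply: (@sum_load F W d cardW d_gt0 om S X al K (2 * k.+1%:R ^+ k)) => //.
- exact: good_closed gd.
- by move=> u uS; have /andP[] := good_X gd uS.
- exact: good_al gd.
have leS : \sum_(u in S) om u * al u <= 2 * n%:R * beta.
  apply: le_trans (good_pot gd); rewrite lerDl sumr_ge0 // => u _.
  by rewrite mulr_ge0 ?pending_ge0.
apply: le_trans (ler_wpM2l _ leS) _; first by rewrite !mulr_ge0 ?exprn_ge0 ?ler0n.
have := ler_wpM2l (ler0n rat n) leK; apply: le_trans.
by rewrite le_eqVlt -/k; apply/orP; left; apply/eqP; ring.
Qed.

Lemma total_load_le2 : total_load S X <= 2.
Proof.
have y0 s : s \in S -> 0 <= k%:R * X s / N.
  move=> sS; have /andP[X0 _] := good_X gd sS.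
  by rewrite divr_ge0 ?ler0n // mulr_ge0 // ltW.
have := prod1D_le y0; rewrite -/(total_load S X) -mulr_suml -mulr_sumr.
(* By [sum_X] the numerator is at most [6 * d * n * K], which [leN] compares with [N]. *)
have le_half : k%:R * (\sum_(s in S) X s) / N <= 2^-1.
  rewrite ler_pdivrMr // -(ler_pM2l (x := 2)) ?mulrA // mulfV // mul1r.
  apply: le_trans leN; rewrite /k -muln2 natrM.
  have := ler_wpM2l (ler0n rat d) sum_X; set T := \sum_(s in S) _ => le_d.
  by rewrite -mulrA; lra.
have := total_load_ge1; set P := total_load _ _; set T := _ / N in le_half *.
by move=> P1 leP; nra.
Qed.

Variable v : F.
Hypotheses (vS : v \notin S) (Wv : W v \subset S).
Let A := avail S f v.

Lemma pending_ready : pending S f X v =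
  N ^+ k * wt k #|A| / (\prod_(w in W v) X w * total_load S X).
Proof.
have WvS : W v :\: S = set0 by apply/eqP; rewrite setD_eq0.
rewrite /pending /phi (setIidPl Wv) WvS cards0 /= divr1.
suff -> : avail S f v :&: common_nbrs e [::] = avail S f v by [].
by apply/setIidPl/subsetP => x _; rewrite inE.
Qed.

Lemma pending_le : pending S f X v <= 2 * n%:R * beta.
Proof.
apply: le_trans (_ : om v * pending S f X v <= _).
  by rewrite ler_peMl ?pending_ge0.
apply: le_trans (good_pot gd); rewrite [X in _ <= _ + X](bigD1 v) ?inE //=.
rewrite addrCA lerDl addr_ge0 // sumr_ge0 // => u.
  move=> uS; rewrite mulr_ge0 //; have := good_al gd uS; have /andP[X0 _] := good_X gd uS.
  have := prodX_gt0 u; rewrite (setIidPl (good_closed gd uS)) => P0 leX.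
  have := le_trans (exprn_ge0 k (ltW X0)) leX.
  by rewrite pmulr_lge0 // pmulr_rge0 // mulr_gt0 // exprn_gt0 ?ltr0n.
by move=> _; rewrite mulr_ge0 ?pending_ge0.
Qed.

(** With no candidate left, [wt k 0 = 1 / k!], while the divisor in [pending] is at most
    [2 * N ^ d]. So [pending] would be at least [N ^ d / (2 * k!)], which [ltN] puts above the bound
    of [pending_le]. *)
Lemma avail_gt0 : (0 < #|A|)%N.
Proof.
rewrite lt0n; apply: contraTneq pending_le => A0; rewrite -ltNge pending_ready A0.
have P0 : 0 < \prod_(w in W v) X w by rewrite -(setIidPl Wv) prodX_gt0.
have L0 : 0 < total_load S X by apply: lt_le_trans total_load_ge1.
rewrite ltr_pdivlMr ?mulr_gt0 // /wt add0n mul1r ltr_pdivlMr ?ltr0n ?fact_gt0 //.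
have leP : \prod_(w in W v) X w <= N ^+ d.
  apply: le_trans (ler_weXn2l N_ge1 (cardW v)); rewrite -prodr_const.
  apply: ler_prod => w wv; have /andP[/ltW-> //] := good_X gd (subsetP Wv w wv).
apply: le_lt_trans (_ : _ <= 2 * n%:R * beta * (N ^+ d * 2) * k`!%:R) _.
  rewrite ler_wpM2r ?ler0n // ler_wpM2l ?mulr_ge0 ?ler0n //.
  by rewrite ler_pM ?total_load_le2 // ltW.
rewrite (_ : _ * _ = (4 * n%:R * beta * k`!%:R) * N ^+ d); last by ring.
by rewrite {2}/k -addnn exprD ltr_pM2r ?exprn_gt0.
Qed.

(** If [v] is an earlier neighbour of [u], the mean of [phi] grows by at most [N / #|A|], the new
    factor [X v]; otherwise by at most [1 + k / #|A|], the new factor of [total_load]. *)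
Lemma sum_pending u : u \notin v |: S -> 
  \sum_(z in A) pending (v |: S) (upd f v z) (upd X v (N / #|A|%:R)) u
  <= #|A|%:R * pending S f X u.
Proof.
move=> uvS; rewrite /pending -mulr_suml.
have A0 : 0 < (#|A|%:R : rat) by rewrite ltr0n avail_gt0.
have P0 := prodX_gt0 u.
have L0 : 0 < total_load S X by apply: lt_le_trans total_load_ge1.
have -> : total_load (v |: S) (upd X v (N / #|A|%:R)) =
          (1 + k%:R / #|A|%:R) * total_load S X.
  rewrite /total_load big_setU1 //= /upd eqxx; congr (_ * _).
    by rewrite mulrA mulrAC mulfK ?gt_eqF.
  by apply: eq_bigr => x xS; case: eqP => // xv; have := vS; rewrite -xv xS.
have eq_prod : \prod_(w in W u :&: S) upd X v (N / #|A|%:R) w = \prod_(w in W u :&: S) X w.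
  apply: eq_bigr => x /setIP[_ xS]; rewrite /upd.
  by case: eqP => // xv; have := vS; rewrite -xv xS.
have c0 : 0 < (1 + k%:R / #|A|%:R : rat) by rewrite ltr_wpDr ?divr_ge0 ?ler0n.
have [vu|vu] := boolP (v \in W u).
  have -> : W u :&: (v |: S) = v |: (W u :&: S).
    by apply/setP=> x; rewrite !inE; have [->|_] := eqVneq x v; rewrite ?vu.
  rewrite big_setU1 ?inE ?negb_and ?vS ?orbT //= eq_prod [upd X v _ v]/upd eqxx.
  rewrite ler_pdivrMr ?mulr_gt0 ?invr_gt0 //.
  have sA : A \subset Ms u.
    apply: subset_trans (VsMs vu); apply/subsetP => x.
    by rewrite !inE => /andP[_ /andP[]].
  apply: le_trans (phi_step_nbr f vS vu sA) _.
  rewrite [leRHS](_ : _ = (1 + k%:R / #|A|%:R) * (N * phi S f u)); last first.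
    by field; rewrite !gt_eqF.
  apply: ler_peMl; first exact: mulr_ge0 (ltW N_gt0) (phi_ge0 _ _ _).
  by rewrite lerDl divr_ge0 ?ler0n.
have -> : W u :&: (v |: S) = W u :&: S.
  by apply/setP=> x; rewrite !inE; have [->|_] := eqVneq x v; rewrite ?(negPf vu).
rewrite eq_prod ler_pdivrMr ?mulr_gt0 //.
apply: le_trans (phi_step_other f A vS vu) _.
rewrite le_eqVlt; apply/orP; left; apply/eqP; rewrite natrD.
by field; rewrite !gt_eqF.
Qed.

(** Averaging over [A] gives a [z] for which the weighted sum of the [pending] terms other than that
    of [v] does not grow. The term of [v] moves unchanged from the second sum of [good_pot] to the
    first. *)
Lemma good_extend : exists z, 
  good (v |: S) (upd f v z) (upd X v (N / #|A|%:R)) (upd al v (pending S f X v)).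
Proof.
have A0 : 0 < (#|A|%:R : rat) by rewrite ltr0n avail_gt0.
have L0 : 0 < total_load S X by apply: lt_le_trans total_load_ge1.
have [z zA le_z] : exists2 z, z \in A &
    \sum_(u in ~: (v |: S)) om u *
      pending (v |: S) (upd f v z) (upd X v (N / #|A|%:R)) u
    <= \sum_(u in ~: (v |: S)) om u * pending S f X u.
  apply: exists_le_mean avail_gt0 _.
  rewrite exchange_big mulr_sumr; apply: ler_sum => u; rewrite inE => uvS /=.
  by rewrite -mulr_sumr mulrCA ler_wpM2l ?sum_pending.
have upd_other (T : Type) (g : F -> T) y u : u \in S -> upd g v y u = g u.
  by rewrite /upd; case: eqP => // -> /(negP vS).
have upd_v (T : Type) (g : F -> T) y : upd g v y v = y by rewrite /upd eqxx.
move: (zA); rewrite !inE => /andP[zf /andP[_ /forall_inP z_adj]].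
exists z; split.
- move=> u /setU1P[->|uS]; first exact: subset_trans Wv (subsetUr _ _).
  exact: subset_trans (good_closed gd uS) (subsetUr _ _).
- move=> x y /setU1P[->|xS] /setU1P[->|yS] //; rewrite ?upd_v ?upd_other //.
  + by move=> zy; case/negP: zf; apply/imsetP; exists y.
  + by move=> zx; case/negP: zf; apply/imsetP; exists x.
  + exact: (good_inj gd).
- move=> u w /setU1P[->|uS] wu.
    rewrite upd_v upd_other; last exact: subsetP wu.
    by apply: z_adj; rewrite inE wu (subsetP Wv).
  rewrite !upd_other //; last exact: subsetP (good_closed gd uS) w wu.
  exact: (good_adj gd).
- move=> u /setU1P[->|uS]; last by rewrite upd_other // (good_X gd).
  rewrite upd_v divr_gt0 // ler_pdivrMr // ler_peMr ?ler0n // ler1n.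
  exact: avail_gt0.
- move=> u /setU1P[->|uS]; last first.
    rewrite !upd_other // (eq_bigr X) ?(good_al gd) // => w wu.
    by rewrite upd_other // (subsetP (good_closed gd uS)).
  rewrite !upd_v (eq_bigr X) => [|w wv]; last by rewrite upd_other // (subsetP Wv).
  have P0 : 0 < \prod_(w in W v) X w by rewrite -(setIidPl Wv) prodX_gt0.
  rewrite pending_ready expr_div_n -exprVn.
  apply: le_trans (ler_wpM2l (exprn_ge0 k (ltW N_gt0)) (wt_ge k avail_gt0)) _.
  (* The factor 2 in [good_al] absorbs [total_load]. *)
  rewrite [leRHS](_ : _ = (2 / total_load S X) * (N ^+ k * (k.+1%:R ^+ k * wt k #|A|))).
    apply: ler_peMl; last by rewrite ler_pdivlMr // mul1r total_load_le2.
    by apply: mulr_ge0 (exprn_ge0 _ (ltW N_gt0)) (mulr_ge0 (exprn_ge0 _ (ler0n _ _)) (wt_ge0 _ _)).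
  by field; rewrite !gt_eqF.
apply: le_trans (good_pot gd); rewrite big_setU1 //= upd_v.
rewrite [X in _ <= _ + X](bigD1 v) ?inE //= addrCA addrA lerD //.
  by rewrite lerD2l le_eqVlt (eq_bigr (fun u => om u * al u)) ?eqxx // => u uS; rewrite upd_other.
apply: le_trans le_z _; rewrite le_eqVlt; apply/orP; left; apply/eqP.
by apply: eq_bigl => u; rewrite !inE negb_or andbC.
Qed.

End Good.

Lemma embed_aux t : (t <= #|F|)%N -> V -> exists S f X al, #|S| = t /\ good S f X al.
Proof.
move=> + x0; elim: t => [_|t IH tF].
  by exists set0, (fun=> x0), (fun=> 1), (fun=> 0); rewrite cards0; split=> //; apply: good0.
have [S [f [X [al [cS gd]]]]] := IH (ltnW tF).
have [v0 v0S] : exists v, v \notin S.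
  apply/existsP; apply: contraLR tF => /existsPn allS; rewrite -ltnNge ltnS -cS.
  by apply/subset_leq_card/subsetP => v _; have := allS v; rewrite negbK.
(* A vertex of least rank outside [S] has all its earlier neighbours in [S]. *)
have [v /= vS vmin] := @arg_minnP _ v0 [pred v | v \notin S] rank v0S.
have Wv : W v \subset S.
  apply/subsetP => w wv; apply: contraT => wS.
  by have := vmin w wS; rewrite leqNgt rankW.
have [z gd'] := good_extend gd vS Wv.
by do 4 eexists; split; last exact: gd'; rewrite cardsU1 vS cS.
Qed.

End Embedding.

(** [Vs u] is the part that receives [u], and [Ms u] contains the parts of its earlier neighbours.
    The three inequalities with numerical constants serve in turn to bound the sum of the loads, to
    keep [total_load] at most 2, and to keep the candidate sets nonempty. *)
Lemma degenerate_embedding (V : finType) (e : rel V) (F : finType) (W : F -> {set F})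
    (rank : F -> nat) (Vs Ms : F -> {set V}) (d n : nat) (beta K : rat) :
    let N : rat := #|V|%:R in
    let k := d.*2 in
    irreflexive e ->
    (forall u w, w \in W u -> (rank w < rank u)%N) ->
    (forall u, (#|W u| <= d)%N) ->
    (0 < d)%N -> (#|F| <= n)%N ->
    (forall u w, w \in W u -> Vs w \subset Ms u) ->
    (forall u m, (m <= d)%N ->
       tsum (Ms u) m (fun l => (N / #|Vs u :&: common_nbrs e l|.+1%:R) ^+ k)
       <= N ^+ m * beta) ->
    1 <= K -> 4 * k%:R ^+ d * k.+1%:R ^+ k * beta <= K ^+ d ->
    12 * d%:R * n%:R * K <= N ->
    4 * n%:R * beta * k`!%:R < N ^+ d ->
    1 <= N -> 0 <= beta ->
  exists f : F -> V, injective f /\ forall u w, w \in W u -> e (f u) (f w).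
Proof.
move=> N k e_irr rankW cardW d0 cardF VsMs sumMs K1 leK leN ltN N1 b0.
have [om [om1 omE sum_om]] := load_exists rankW cardW d0.
have x0 : V.
  have /card_gt0P/sigW[x _] // : (0 < #|V|)%N by move: N1; rewrite ler1n.
have sum_om_n : \sum_u om u <= 2 * n%:R.
  by apply: le_trans sum_om _; rewrite ler_pM2l // ler_nat.
have [S [f [X [al [cS gd]]]]] := embed_aux e_irr rankW cardW d0 VsMs sumMs K1
  leK leN ltN N1 b0 om1 omE sum_om_n (leqnn _) x0.
have ST x : x \in S.
  suff -> : S = setT by rewrite inE.
  by apply/eqP; rewrite eqEcard subsetT cardsT cS leqnn.
exists f; split=> [x y|u w wu]; first exact: (good_inj gd).
exact: (good_adj gd).
Qed.

(** * Dependent random choice in one set *)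

Lemma in_common_nbrs_sym (V : finType) (e : rel V) (l T : seq V) :
  symmetric e -> all [in common_nbrs e T] l = all [in common_nbrs e l] T.
Proof.
move=> e_sym; apply/allP/allP => le x xl; rewrite inE; apply/allP => y yl;
by have := le y yl; rewrite inE => /allP/(_ x xl); rewrite e_sym.
Qed.

Section Choice.
Variables (V : finType) (e : bool -> rel V).
Hypothesis e_sym : forall b, symmetric (e b).
Hypothesis e_total : forall x y, x != y -> e true x y || e false x y.

(** If both colour degrees of [x] in [A] were below [#|A| / 4], their sum would be below [#|A| - 1],
    as [#|A| > 1]. So each vertex is rich in some colour, and one colour serves at least half of
    them. *)
Lemma majority_color (A : {set V}) : (1 < #|A|)%N ->
  exists c (B : {set V}), [/\ B \subset A, (#|A| <= #|B|.*2)%N &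
    forall x, x \in B -> (#|A| <= 4 * #|[set y in A | e c x y]|)%N].
Proof.
move=> A1; pose B c := [set x in A | (#|A| <= 4 * #|[set y in A | e c x y]|)%N].
have sB c : B c \subset A by apply/subsetP => x; rewrite inE => /andP[].
have leB c x : x \in B c -> (#|A| <= 4 * #|[set y in A | e c x y]|)%N.
  by rewrite inE => /andP[].
have : (#|A| <= #|B true| + #|B false|)%N.
  apply: leq_trans (leq_card_setU _ _); apply/subset_leq_card/subsetP => x xA.
  rewrite !inE xA /= -implyNb -ltnNge; apply/implyP => lt1.
  have : (#|A :\ x| <= #|[set y in A | e true x y]| + #|[set y in A | e false x y]|)%N.
    apply: leq_trans (leq_card_setU _ _); apply/subset_leq_card/subsetP => y.
    rewrite !inE => /andP[yx ->] /=; apply: e_total; by rewrite eq_sym.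
  have := cardsD1 x A; rewrite xA; lia.
case: (leqP #|A| #|B true|.*2) => [le1 _|gt1 le2].
  by exists true, (B true); split=> //; apply: leB.
by exists false, (B false); split=> //; [lia | apply: leB].
Qed.

(** Double counting of the pairs of a vertex of [A] and a tuple in its neighbourhood. *)
Lemma tsum_card_common (A B : {set V}) c s : B \subset A ->
  (forall x, x \in B -> (#|A| <= 4 * #|[set y in A | e c x y]|)%N) ->
  #|B|%:R * (#|A|%:R / 4) ^+ s <=
  tsum A s (fun T => #|A :&: common_nbrs (e c) T|%:R).
Proof.
move=> sB leB; have -> : tsum A s (fun T => #|A :&: common_nbrs (e c) T|%:R) =
    \sum_(x in A) #|[set y in A | e c x y]|%:R ^+ s.
  under [RHS]eq_bigr do rewrite -tsum_all.
  rewrite -tsum_sum; apply: eq_tsum => l _.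
  rewrite -sum1_card natr_sum big_mkcond [RHS]big_mkcond; apply: eq_bigr => x _ /=.
  by rewrite !inE; case: (x \in A); case: all.
rewrite (big_setID B) /= (setIidPr sB) -[leLHS]addr0 lerD //; last first.
  by apply: sumr_ge0 => x _; rewrite exprn_ge0 ?ler0n.
rewrite mulr_natl -sumr_const; apply: ler_sum => x xB.
apply: lerXn2r; rewrite ?nnegrE ?divr_ge0 ?ler0n //.
by rewrite ler_pdivrMr // -natrM ler_nat mulnC leB.
Qed.

(** The colour is fixed before the functions [H j], which depend on it in the application. A tuple
    with [g T > \sum_j h j T] gives both claims: [g T > 0] is the size bound, and [h j T <= 1]
    follows from [g T <= 1]. *)
Lemma dependent_choice (A : {set V}) s : (1 < #|A|)%N ->
  exists c, forall (J : finType) (H : J -> seq V -> rat) (K : J -> rat),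
    (forall j, 0 < K j) -> (forall j T, 0 <= H j T) ->
    (forall j, tsum A s (H j) <= K j) ->
  exists T, (#|A| <= 8 * 4 ^ s * #|A :&: common_nbrs (e c) T|)%N /\
    forall j, H j T * #|A|%:R ^+ s <= 4 * #|J|%:R * 4 ^+ s * K j.
Proof.
move=> A1; have [c [B [sB cardB leB]]] := majority_color A1.
have a0 : 0 < (#|A|%:R : rat) by rewrite ltr0n (ltn_trans _ A1).
exists c => J H K K0 H0 leK.
set a : rat := #|A|%:R in a0 *; pose eps : rat := (4 ^+ s)^-1.
have eps0 : 0 < eps by rewrite invr_gt0 exprn_gt0.
pose theta : rat := a ^+ s * eps / (4 * #|J|%:R).
have theta0 : 0 <= theta.
  by rewrite divr_ge0 ?mulr_ge0 ?exprn_ge0 ?ler0n // ltW.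
pose g T : rat := #|A :&: common_nbrs (e c) T|%:R / a - eps / 8.
pose h j T : rat := theta / K j * H j T.
have h0 j T : 0 <= h j T by rewrite mulr_ge0 // divr_ge0 // ltW.
have : 0 < tsum A s (fun T => g T - \sum_j h j T).
  have leh : tsum A s (fun T => \sum_j h j T) <= a ^+ s * eps / 4.
    rewrite tsum_sum; apply: le_trans (_ : _ <= \sum_(j : J) theta) _.
      apply: ler_sum => j _; rewrite tsumZ mulrAC ler_pdivrMr // mulrC.
      by rewrite [leRHS]mulrC ler_wpM2r.
    rewrite sumr_const -[leLHS]mulr_natl /theta.
    have [J0|J0] := posnP #|J|.
      by rewrite J0 mul0r divr_ge0 // mulr_ge0 ?exprn_ge0 ?ler0n // ltW.
    rewrite le_eqVlt; apply/orP; left; apply/eqP; field.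
    by rewrite pnatr_eq0 -lt0n.
  have leg : a ^+ s * eps / 2 - a ^+ s * eps / 8 <= tsum A s g.
    rewrite tsumD tsum_const -/a mulrN mulrA lerD2r.
    have -> : tsum A s (fun T => #|A :&: common_nbrs (e c) T|%:R / a) =
              a^-1 * tsum A s (fun T => #|A :&: common_nbrs (e c) T|%:R).
      by rewrite -tsumZ; apply: eq_tsum => T _; rewrite mulrC.
    rewrite ler_pdivlMl //; apply: le_trans (tsum_card_common s sB leB).
    rewrite -/a expr_div_n -/eps.
    rewrite [leLHS](_ : _ = a / 2 * (a ^+ s * eps)); last by field.
    rewrite ler_wpM2r ?mulr_ge0 ?exprn_ge0 ?ler0n ?(ltW eps0) //.
    by rewrite ler_pdivrMr // -natrM ler_nat muln2.
  have -> : tsum A s (fun T => g T - \sum_j h j T) =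
     tsum A s g - tsum A s (fun T => \sum_j h j T).
    rewrite tsumD; congr (_ + _); rewrite -[RHS]mulN1r -tsumZ.
    by apply: eq_tsum => T _; rewrite mulN1r.
  have : 0 < a ^+ s * eps by rewrite mulr_gt0 // exprn_gt0.
  by move=> pos; lra.
case/tsum_gt0_ex => T [_ _]; rewrite subr_gt0 => ltg; exists T.
have sum0 : 0 <= \sum_j h j T by apply: sumr_ge0.
split.
  have : eps / 8 <= #|A :&: common_nbrs (e c) T|%:R / a.
    by rewrite -subr_ge0; apply: le_trans sum0 (ltW ltg).
  rewrite ler_pdivlMr // -(ler_nat rat) !natrM natrX -/a => le_a.
  rewrite -(ler_pM2l eps0); apply: le_trans (_ : 8 * (eps / 8 * a) <= _).
    by rewrite le_eqVlt; apply/orP; left; apply/eqP; field.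
  rewrite [leRHS](_ : _ = 8 * #|A :&: common_nbrs (e c) T|%:R) ?ler_pM2l //.
  by rewrite /eps; field; rewrite expf_neq0.
move=> j; have J0 : 0 < (#|J|%:R : rat) by rewrite ltr0n; apply/card_gt0P; exists j.
have : h j T <= 1.
  apply: le_trans (_ : _ <= \sum_j h j T) _.
    by rewrite (bigD1 j) //= lerDl sumr_ge0.
  apply: le_trans (ltW ltg) _; apply: le_trans (_ : _ <= #|A :&: common_nbrs (e c) T|%:R / a) _.
    by rewrite lerBlDr lerDl divr_ge0 // ltW.
  by rewrite ler_pdivrMr // mul1r ler_nat subset_leq_card // subsetIl.
have -> : h j T = H j T * a ^+ s / (4 * #|J|%:R * 4 ^+ s * K j).
  by rewrite /h /theta /eps; field; rewrite expf_neq0 // !gt_eqF.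
by rewrite ler_pdivrMr ?mul1r // !mulr_gt0 ?exprn_gt0.
Qed.

End Choice.

(** * A chain of dependent random choices *)

Section Chain.
Variables (V : finType) (e : bool -> rel V).
Hypothesis e_sym : forall b, symmetric (e b).
Hypothesis e_total : forall x y, x != y -> e true x y || e false x y.
Let N : rat := #|V|%:R.

Definition rarity b s (C : {set V}) (l : seq V) : rat :=
  (N / #|C :&: common_nbrs (e b) l|.+1%:R) ^+ s.

Lemma rarity_ge0 b s C l : 0 <= rarity b s C l.
Proof. by rewrite exprn_ge0 // divr_ge0 ?ler0n. Qed.

Lemma rarity_anti b s (C C' : {set V}) l l' :
  C' :&: common_nbrs (e b) l' \subset C :&: common_nbrs (e b) l ->
  rarity b s C l <= rarity b s C' l'.
Proof.
move=> sC; apply: lerXn2r; rewrite ?nnegrE ?divr_ge0 ?ler0n //.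
rewrite ler_wpM2l ?ler0n // lef_pV2 ?posrE ?ltr0n // ler_nat ltnS.
exact: subset_leq_card.
Qed.

Lemma common_nbrs_cat b l l' :
  common_nbrs (e b) (l ++ l') = common_nbrs (e b) l :&: common_nbrs (e b) l'.
Proof. by apply/setP => x; rewrite !inE all_cat. Qed.

(* Dependent random choice: a tuple survives with probability
   [|A :&: common_nbrs l| / |A|] to the power [s], which [rarity] compensates. *)
Lemma tsum_rarity (A : {set V}) b s m d :
  tsum A s (fun T => tsum (A :&: common_nbrs (e b) T) m (fun R =>
    tsum (common_nbrs (e b) T) d (fun Q => rarity b s A (R ++ Q)))) <= N ^+ (s + m + d).
Proof.
have le_N (B : {set V}) j : (#|B|%:R : rat) ^+ j <= N ^+ j.
  by apply: lerXn2r; rewrite ?nnegrE ?ler0n // ler_nat max_card.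
(* By symmetry, [R] and [Q] consist of common neighbours of [T] exactly when [T] consists of common
   neighbours of [R ++ Q]; the sum over [T] can then go innermost. *)
have -> : tsum A s (fun T => tsum (A :&: common_nbrs (e b) T) m (fun R =>
    tsum (common_nbrs (e b) T) d (fun Q => rarity b s A (R ++ Q)))) =
  tsum A m (fun R => tsum setT d (fun Q => tsum A s (fun T =>
     rarity b s A (R ++ Q) * (all [in common_nbrs (e b) (R ++ Q)] T)%:R))).
  under [RHS]eq_tsum => R _ do rewrite exchange_tsum.
  rewrite [RHS]exchange_tsum; apply: eq_tsum => T _; rewrite tsum_setI.
  apply: eq_tsum => R _; rewrite -[common_nbrs (e b) T]setTI tsum_setI.
  under [RHS]eq_tsum => Q _ do
    rewrite -(in_common_nbrs_sym _ _ (e_sym b)) all_cat.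
  rewrite setTI; case: all => /=; last first.
    rewrite -[LHS](mulr0 (#|[set: V]|%:R ^+ d)) -tsum_const.
    by apply: eq_tsum => Q _; rewrite mulr0.
  by apply: eq_tsum => Q _; case: all; rewrite ?mulr1 ?mulr0.
apply: le_trans (_ : _ <= tsum A m (fun=> tsum [set: V] d (fun=> N ^+ s))) _; last first.
  rewrite (_ : s + m + d = m + (d + s))%N; last by lia.
  by rewrite !tsum_const cardsT -/N -exprD [leRHS]exprD ler_wpM2r ?exprn_ge0 ?ler0n.
apply: ler_tsum => R _; apply: ler_tsum => Q _.
rewrite tsumZ tsum_all /rarity expr_div_n mulrAC ler_pdivrMr ?exprn_gt0 ?ltr0n //.
rewrite ler_wpM2l ?exprn_ge0 ?ler0n //; apply: lerXn2r; rewrite ?nnegrE ?ler0n //.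
rewrite ler_nat leqW //; apply/subset_leq_card/subsetP => x; rewrite !inE.
Qed.

Variables (q d : nat) (s m : nat -> nat).
Hypothesis mE : forall i, (i < q)%N -> m i = (s i + m i.+1)%N.
Hypothesis s_ge2 : forall i, (i < q)%N -> (2 <= s i)%N.
Hypothesis q_small : (q <= 4 ^ m 0)%N.
Hypothesis V_large : (2 * 16 ^ m 0 <= #|V|)%N.
Let L : rat := 16 ^+ m 0.

Lemma m_anti i j : (i <= j <= q)%N -> (m j <= m i)%N.
Proof.
case/andP; elim: j => [|j IH]; first by rewrite leqn0 => /eqP->.
rewrite leq_eqVlt => /predU1P[-> //|ij] jq; apply: leq_trans (IH ij (ltnW jq)).
by rewrite (mE jq) leq_addl.
Qed.

(** In the construction, [M j] is the common neighbourhood of the tuple of step [j], and [C j] is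
    the set [A] of that step, cut by the later tuples of the same colour. The moment is averaged
    over the [m i] vertices [R] that later steps have still to choose, so that a new tuple merely
    fixes a part of [R]. *)
Lemma chain i : (i <= q)%N ->
  exists (A : {set V}) (c : nat -> bool) (M C : nat -> {set V}),
  [/\ forall j, (j < i)%N -> A \subset M j,
      forall j l, (j < i)%N -> (l < i)%N -> j != l -> c j = c l -> C l \subset M j,
      (#|V| <= #|A| * 16 ^ (m 0 - m i))%N &
      forall j, (j < i)%N ->
        tsum A (m i) (fun R => tsum (M j) d (fun Q =>
          rarity (c j) (s j) (C j) (R ++ Q)))
        <= N ^+ (d + m i) * L ^+ (2 * (m j - m i))].
Proof.
elim: i => [_|i IH iq].
  exists setT, (fun=> true), (fun=> setT), (fun=> setT); split=> //.
  by rewrite subnn muln1 cardsT.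
have [A [c [M [C [AM CM cardA sumA]]]]] := IH (ltnW iq).
have m0i : (m i <= m 0)%N by apply: m_anti; rewrite leq0n ltnW.
have mi := mE iq; have si := s_ge2 iq.
have cardAL : (#|V| <= #|A| * 16 ^ m 0)%N.
  apply: leq_trans cardA _; rewrite leq_mul // leq_exp2l //; lia.
have A1 : (1 < #|A|)%N.
  have := leq_trans V_large cardAL; rewrite leq_pmul2r ?expn_gt0 //.
have V0 : (0 < #|V|)%N by apply: leq_trans V_large; rewrite muln_gt0 expn_gt0.
have N0 : 0 < N by rewrite ltr0n.
have L0 : 0 < L by rewrite exprn_gt0.
have [c0 choice] := dependent_choice e_total (s i) A1.
pose c' j := if j == i then c0 else c j.
pose M' T j := if j == i then common_nbrs (e c0) T else M j.
(* Cutting an older [C j] puts it inside the new [M' T i]; the new set [A] already lies in every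
   older [M j]. *)
pose C' T j := if j == i then A
               else if c j == c0 then C j :&: common_nbrs (e c0) T else C j.
pose A' T := A :&: common_nbrs (e c0) T.
pose H (j : 'I_i.+1) T := tsum (A' T) (m i.+1) (fun R => tsum (M' T j) d (fun Q =>
          rarity (c' j) (s j) (C' T j) (R ++ Q))).
pose K (j : 'I_i.+1) : rat := N ^+ (d + m i) * L ^+ (2 * (m j - m i)).
have K0 j : 0 < K j by rewrite mulr_gt0 ?exprn_gt0.
have H0 j T : 0 <= H j T.
  by apply: tsum_ge0 => R; apply: tsum_ge0 => Q; apply: rarity_ge0.
have leK j : tsum A (s i) (H j) <= K j.
  rewrite /H /K /M' /c' /C'; case: (eqVneq (j : nat) i) => [->|ji].
    rewrite subnn mulr1 addnC mi; exact: tsum_rarity.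
  have lt_ji : (j < i)%N by rewrite ltn_neqAle ji -ltnS ltn_ord.
  apply: le_trans (sumA j lt_ji); rewrite mi tsum_cat; apply: ler_tsum => T _.
  apply: le_trans (tsum_subset _ (subsetIl _ _) _) _.
    by move=> R; apply: tsum_ge0 => Q; apply: rarity_ge0.
  apply: ler_tsum => R _; apply: ler_tsum => Q _; apply: rarity_anti.
  rewrite -catA common_nbrs_cat; case: eqP => [->|_]; first by rewrite setIA.
  by apply: setIS; apply: subsetIr.
have [T [cardT leT]] := choice _ H K K0 H0 leK.
exists (A' T), c', (M' T), (C' T); split.
- move=> j; rewrite ltnS leq_eqVlt /M' => /predU1P[->|ji].
    by rewrite eqxx subsetIr.
  by rewrite ltn_eqF // (subset_trans (subsetIl _ _)) ?AM.
- move=> j l; rewrite !ltnS (leq_eqVlt j) (leq_eqVlt l) /M' /C' /c'.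
  move=> /predU1P[->|ji] /predU1P[->|li].
  + by rewrite eqxx.
  + by rewrite eqxx (ltn_eqF li) => _ <-; rewrite eqxx subsetIr.
  + by rewrite eqxx (ltn_eqF ji) => _ _; apply: AM.
  rewrite (ltn_eqF ji) (ltn_eqF li) => jl cjl; apply: subset_trans (CM j l ji li jl cjl).
  by case: ifP => // _; apply: subsetIl.
- apply: leq_trans cardA _.
  have -> : (m 0 - m i.+1 = s i + (m 0 - m i))%N by lia.
  rewrite expnD mulnA leq_mul // mulnC; apply: leq_trans cardT _.
  (* Here [8 * 4 ^ s i <= 16 ^ s i], because [s i >= 2]. *)
  rewrite leq_mul // (_ : 16 = 4 * 4)%N // expnMn leq_mul //.
  by apply: leq_trans (_ : 4 ^ 2 <= _)%N => //; rewrite leq_exp2l.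
move=> j ji; have := leT (Ordinal ji); rewrite /H /= card_ord => leH.
have Ns : 0 < N ^+ s i by rewrite exprn_gt0.
rewrite -(ler_pM2r Ns).
(* One factor [L ^+ s i] pays for [#|A|] being smaller than [N], a second one for the constant of
   [dependent_choice]; hence the 2 in the exponent of [L]. *)
apply: le_trans (_ : H (Ordinal ji) T * (#|A|%:R ^+ s i * L ^+ s i) <= _).
  apply: ler_wpM2l; first exact: (H0 (Ordinal ji) T).
  rewrite -exprMn; apply: lerXn2r; rewrite ?nnegrE ?mulr_ge0 ?ler0n //.
    exact: ltW.
  by rewrite /L -natrX -natrM ler_nat.
rewrite mulrA; apply: le_trans (ler_wpM2r (exprn_ge0 _ (ltW L0)) leH) _.
have leL : 4 * i.+1%:R * 4 ^+ s i <= L ^+ s i.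
  rewrite /L -!natrX -!natrM ler_nat.
  apply: leq_trans (_ : 4 * 4 ^ m 0 * 4 ^ s i <= _)%N.
    by rewrite leq_mul // leq_mul // (leq_trans iq).
  rewrite -expnS -expnD (_ : 16 = 4 ^ 2)%N // -!expnM leq_exp2l //.
  by have : (s i <= m 0)%N; [rewrite (leq_trans _ m0i) // mi leq_addr | nia].
apply: le_trans (_ : L ^+ s i * K (Ordinal ji) * L ^+ s i <= _).
  by rewrite ler_wpM2r ?exprn_ge0 ?(ltW L0) // ler_wpM2r // ltW.
have mij : (m i <= m j)%N by apply: m_anti; rewrite -ltnS ji ltnW.
rewrite /K /= (_ : m j - m i.+1 = (m j - m i) + s i)%N; last by lia.
move: (m j - m i)%N => x; rewrite mi le_eqVlt; apply/orP; left; apply/eqP.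
rewrite (_ : 2 * (x + s i) = 2 * x + s i + s i)%N; last by lia.
by rewrite !exprD; move: (L ^+ (2 * x)) => y; ring.
Qed.

End Chain.

(** * One colour and moments of order [2 * d] *)

Lemma expr_le1D (x : rat) a b : 0 <= x -> (a <= b)%N -> x ^+ a <= 1 + x ^+ b.
Proof.
move=> x0 ab; have [x1|x1] := leP x 1.
  by rewrite -[leLHS]addr0 lerD ?exprn_ge0 // exprn_ile1.
by rewrite -[leLHS]add0r lerD // ler_weXn2l // ltW.
Qed.

(* [tsum M d] controls the shorter tuples because appending vertices only
   shrinks the common neighbourhood. *)
Lemma tsum_lower_power (V : finType) (M : {set V}) (X : seq V -> rat) (L : rat) m d s :
  let N : rat := #|V|%:R in
  (0 < d)%N -> (m <= d)%N -> (d.*2 <= s)%N -> 2 <= L -> N <= L * #|M|%:R -> 0 < N ->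
  (forall l, 0 <= X l) -> (forall l l', X l <= X (l ++ l')) ->
  tsum M d (fun l => X l ^+ s) <= N ^+ d * L ^+ (4 * s) ->
  tsum M m (fun l => X l ^+ d.*2) <= N ^+ m * L ^+ (12 * d).
Proof.
move=> N d0 md ds L2 NL N0 X0 Xcat leX.
have L0 : 0 < L by apply: lt_le_trans L2.
have L1 : 1 <= L by apply: le_trans L2.
have M0 : 0 < (#|M|%:R : rat).
  by have := lt_le_trans N0 NL; rewrite pmulr_rgt0.
have MN : #|M|%:R <= N by rewrite ler_nat max_card.
have le_m : tsum M m (fun l => X l ^+ s) <= N ^+ m * L ^+ (5 * s).
  have le1 : #|M|%:R ^+ (d - m) * tsum M m (fun l => X l ^+ s) <= N ^+ d * L ^+ (4 * s).
    apply: le_trans leX; rewrite -{2}(subnKC md) tsum_cat -tsumZ.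
    apply: ler_tsum => l _; rewrite -tsum_const; apply: ler_tsum => l' _.
    by apply: lerXn2r; rewrite ?nnegrE.
  have Nd0 : 0 < N ^+ (d - m) by rewrite exprn_gt0.
  have le2 : N ^+ (d - m) <= L ^+ (d - m) * #|M|%:R ^+ (d - m).
    by rewrite -exprMn; apply: lerXn2r; rewrite ?nnegrE ?mulr_ge0 // ltW.
  have T0 : 0 <= tsum M m (fun l => X l ^+ s).
    by apply: tsum_ge0 => l; rewrite exprn_ge0.
  rewrite -(ler_pM2l Nd0); apply: le_trans (ler_wpM2r T0 le2) _.
  rewrite -mulrA; apply: le_trans (ler_wpM2l _ le1) _; first by rewrite exprn_ge0 // ltW.
  have -> : N ^+ d = N ^+ (d - m) * N ^+ m by rewrite -exprD subnK.
  have -> : L ^+ (5 * s) = L ^+ s * L ^+ (4 * s) by rewrite -exprD.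
  rewrite [leLHS](_ : _ = (N ^+ (d - m) * N ^+ m * L ^+ (4 * s)) * L ^+ (d - m)); last by ring.
  rewrite [leRHS](_ : _ = (N ^+ (d - m) * N ^+ m * L ^+ (4 * s)) * L ^+ s); last by ring.
  apply: ler_wpM2l; first by rewrite !mulr_ge0 ?exprn_ge0 // ltW.
  apply: ler_weXn2l => //; apply: leq_trans (leq_subr m d) _.
  by apply: leq_trans ds; rewrite -addnn leq_addr.
have L5 : 0 < L ^+ 5 by apply: exprn_gt0.
(* Comparing [X l] with [L ^+ 5], the scale of its [s]-th moment, replaces an appeal to the Hoelder
   inequality and makes the exponent of [L] proportional to [d] instead of [s]. *)
apply: le_trans (_ : _ <= tsum M m (fun l => (L ^+ 5) ^+ d.*2 * (1 + (X l / L ^+ 5) ^+ s))) _.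
  apply: ler_tsum => l _.
  rewrite -[X in X ^+ d.*2](divfK (lt0r_neq0 L5)) exprMn mulrC.
  apply: ler_wpM2l; first by rewrite exprn_ge0 // ltW.
  by apply: expr_le1D => //; rewrite divr_ge0 // ltW.
rewrite tsumZ tsumD tsum_const mulr1.
have -> : tsum M m (fun l => (X l / L ^+ 5) ^+ s) = (L ^+ 5 ^+ s)^-1 * tsum M m (fun l => X l ^+ s).
  by rewrite -tsumZ; apply: eq_tsum => l _; rewrite expr_div_n mulrC.
have le3 : (L ^+ 5 ^+ s)^-1 * tsum M m (fun l => X l ^+ s) <= N ^+ m.
  by rewrite ler_pdivrMl ?exprn_gt0 // mulrC -exprM.
have le4 : #|M|%:R ^+ m <= N ^+ m by apply: lerXn2r; rewrite ?nnegrE // ltW.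
apply: le_trans (_ : _ <= L ^+ 5 ^+ d.*2 * (N ^+ m + N ^+ m)) _.
  by apply: ler_wpM2l; [rewrite !exprn_ge0 // ltW | apply: lerD].
have L2d : 2 <= L ^+ (2 * d) by apply: le_trans L2 _; apply: ler_eXnr; rewrite ?muln_gt0.
rewrite -exprM -mul2n mulnA.
rewrite (_ : 12 * d = 10 * d + 2 * d)%N; last by rewrite -mulnDl.
rewrite exprD -mulr2n -mulr_natr mulrCA; apply: ler_wpM2l; first by rewrite exprn_ge0 // ltW.
by apply: ler_wpM2l L2d; rewrite exprn_ge0 // ltW.
Qed.

Section Structure.
Variables (V : finType) (e : bool -> rel V).
Hypothesis e_sym : forall b, symmetric (e b).
Hypothesis e_total : forall x y, x != y -> e true x y || e false x y.

Lemma pigeonhole_color (c : nat -> bool) r : exists b (f : 'I_r -> nat),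
  [/\ injective f, forall j, (f j < r.*2)%N & forall j, c (f j) = b].
Proof.
pose s b := [seq i <- iota 0 r.*2 | c i == b].
have [b rb] : exists b, (r <= size (s b))%N.
  have : (size (s true) + size (s false) = r.*2)%N.
    rewrite !size_filter -[RHS](size_iota 0) -(count_predC (fun i => c i == true)).
    by congr (_ + _)%N; apply: eq_count => i /=; case: (c i).
  by case: (leqP r (size (s true))) => [|lt1 eq2]; [exists true | exists false; lia].
exists b, (fun j => nth 0%N (s b) j).
have mem_s (j : 'I_r) : nth 0%N (s b) j \in s b by rewrite mem_nth // (leq_trans _ rb).
split=> [j l|j|j].
- move/eqP; rewrite nth_uniq ?(leq_trans _ rb) ?filter_uniq ?iota_uniq //.
  by move/eqP/val_inj.
- by have := mem_s j; rewrite mem_filter mem_iota => /andP[_].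
- by have := mem_s j; rewrite mem_filter => /andP[/eqP].
Qed.

(** Of [2 * r] steps of the chain, [r] share a colour. The tuple lengths [s i] halve down to
    [2 * d], and their tails satisfy [m i <= 2 * s i]; so the loss is at most the [4 * s i]-th power
    of [16 ^ D], as [tsum_lower_power] requires. *)
Lemma two_color_structure r d :
  let N : rat := #|V|%:R in let D := (d * (4 ^ r).*2.-2)%N in
  (0 < d)%N -> (0 < r)%N -> (2 * 16 ^ D <= #|V|)%N ->
  exists b (Vs Ms : 'I_r -> {set V}),
    (forall j l, j != l -> Vs l \subset Ms j) /\
    forall j m, (m <= d)%N ->
      tsum (Ms j) m (fun l => (N / #|Vs j :&: common_nbrs (e b) l|.+1%:R) ^+ d.*2)
      <= N ^+ m * (16 ^+ D) ^+ (12 * d).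
Proof.
move=> N D d0 r0 leV; pose q := r.*2.
pose s i := (d * 2 ^ (q - i))%N; pose m i := (d * (2 ^ (q - i)).*2.-2)%N.
have mD : m 0 = D by rewrite /m subn0 /q -[r.*2]mul2n expnM.
have mE i : (i < q)%N -> m i = (s i + m i.+1)%N.
  move=> iq; rewrite /m /s -mulnDr; congr (_ * _)%N.
  have -> : (q - i = (q - i.+1).+1)%N by lia.
  by rewrite expnS; have := expn_gt0 2 (q - i.+1); lia.
have s2 i : (i < q)%N -> (2 * d <= s i)%N.
  move=> iq; rewrite /s mulnC leq_mul // -{1}(expn1 2) leq_exp2l //; lia.
have s_ge2 i : (i < q)%N -> (2 <= s i)%N.
  by move=> /s2; lia.
have q_small : (q <= 4 ^ m 0)%N.
  rewrite mD /q; apply: leq_trans (ltnW (ltn_expl D _)) => //.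
  have lt_r : (r < 4 ^ r)%N by apply: ltn_expl.
  apply: leq_trans (leq_pmull _ d0); lia.
rewrite -mD in leV *.
have [A [c [M [C [AM CM cardA sumA]]]]] := chain e_sym e_total d mE s_ge2 q_small leV (leqnn q).
have m0_gt0 : (0 < m 0)%N.
  rewrite mD; have lt_r : (r < 4 ^ r)%N by apply: ltn_expl.
  by apply: leq_trans (leq_pmull _ d0); lia.
have mq : m q = 0%N by rewrite /m subnn muln0.
have [b [f [f_inj f_lt cf]]] := pigeonhole_color c r.
exists b, (C \o f), (M \o f); split=> [j l jl|j k kd].
  by apply: CM; rewrite ?f_lt ?cf // (inj_eq f_inj).
have V0 : (0 < #|V|)%N by apply: leq_trans leV; rewrite muln_gt0 expn_gt0.
have N0 : 0 < N by rewrite ltr0n.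
apply: (@tsum_lower_power V (M (f j))
  (fun l => N / #|C (f j) :&: common_nbrs (e b) l|.+1%:R) _ k d (s (f j))) => //.
- by rewrite -mul2n s2.
- by apply: (le_trans _ (ler_eXnr m0_gt0 _)).
- rewrite -natrX -natrM ler_nat mulnC; apply: leq_trans cardA _.
  by rewrite mq subn0 leq_mul // subset_leq_card // AM.
- by move=> l; rewrite divr_ge0 // ltW.
- move=> l l'; rewrite ler_wpM2l ?(ltW N0) // lef_pV2 ?posrE ?ltr0n // ler_nat ltnS.
  by rewrite subset_leq_card // setIS // common_nbrs_cat subsetIl.
have := sumA (f j) (f_lt j); rewrite mq addn0 subn0 /= /rarity cf => leS.
apply: le_trans leS _; rewrite -/N; apply: ler_wpM2l; first by rewrite exprn_ge0 // ltW.
apply: ler_weXn2l; first by apply: exprn_ege1.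
rewrite (_ : 4 = 2 * 2)%N // -mulnA leq_mul // /m /s mulnCA leq_mul // mul2n.
exact: leq_trans (leq_pred _) (leq_pred _).
Qed.

End Structure.

Local Close Scope ring_scope.

(** * Degeneracy orderings *)

Section Induced.
Variables (G : sgraph) (S : {set G}).

Definition induced_adj : rel {x | x \in S} := fun x y => adj (val x) (val y).

Lemma induced_adj_sym : symmetric induced_adj.
Proof. by move=> x y; apply: adj_sym. Qed.

Lemma induced_adj_irrefl : irreflexive induced_adj.
Proof. by move=> x; apply: adj_irrefl. Qed.

Definition induced : sgraph := SGraph induced_adj_sym induced_adj_irrefl.

Lemma contains_induced : contains G induced.
Proof. by exists val; split=> //; apply: val_inj. Qed.

End Induced.

Lemma degenerate_low_degree (d : nat) (G : sgraph) (S : {set G}) :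
  degenerate d G -> S != set0 ->
  exists2 x, x \in S & #|[set y in S | adj x y]| <= d.
Proof.
move=> degG /set0Pn[x0 x0S].
have [|[x xS] le_d] := degG (induced S) _ (contains_induced S).
  by apply/card_gt0P; exists (exist _ x0 x0S).
exists x => //; apply: leq_trans le_d; rewrite /degree -(card_imset _ val_inj).
apply/subset_leq_card/subsetP => y; rewrite inE => /andP[yS xy].
by apply/imsetP; exists (exist _ y yS); rewrite ?inE.
Qed.

(** A vertex with at most [d] neighbours in [S] receives the top rank, which is free because the
    ranks of the other vertices are kept below it; the peeling then continues in the rest. *)
Lemma degenerate_rank (d : nat) (G : sgraph) : degenerate d G ->
  exists rank : G -> nat, injective rank /\
    forall x, #|[set y | adj x y & rank y < rank x]| <= d.
Proof.
move=> degG.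
suff /(_ #|G| setT) [|rank [inj_rank _ le_d]] : forall n (S : {set G}), #|S| = n ->
    exists rank : G -> nat, [/\ {in S &, injective rank},
      forall x, x \in S -> rank x < n &
      forall x, x \in S -> #|[set y in S | adj x y & rank y < rank x]| <= d].
- by rewrite cardsT.
- exists rank; split=> [x y|x]; first exact: inj_rank.
  apply: leq_trans (le_d x (in_setT _)); apply/subset_leq_card/subsetP => y.
  by rewrite !inE.
elim=> [|n IH] S cardS.
  by exists (fun=> 0); move/cards0_eq: cardS => ->; split=> x; rewrite ?inE // => y; rewrite inE.
have [|x xS le_x] := degenerate_low_degree (S := S) degG.
  by rewrite -card_gt0 cardS.
have [|rank [inj_rank lt_rank le_d]] := IH (S :\ x).
  by move: cardS; rewrite (cardsD1 x) xS => -[].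
have inD y : y \in S -> y != x -> y \in S :\ x by move=> yS yx; rewrite !inE yx.
exists (fun y => if y == x then n else rank y); split.
- move=> y z yS zS; case: (eqVneq y x) => [->|yx]; case: (eqVneq z x) => [->|zx] //.
  + by move=> eqn; have := lt_rank z (inD z zS zx); rewrite -eqn ltnn.
  + by move=> eqn; have := lt_rank y (inD y yS yx); rewrite eqn ltnn.
  + by apply: inj_rank; apply: inD.
- move=> y yS; case: (eqVneq y x) => [//|yx].
  by apply: leq_trans (lt_rank y (inD y yS yx)) _.
move=> y yS; case: (eqVneq y x) => [->|yx].
  apply: leq_trans le_x; apply/subset_leq_card/subsetP => z.
  by rewrite !inE => /and3P[-> ->].
apply: leq_trans (le_d y (inD y yS yx)); apply/subset_leq_card/subsetP => z.
rewrite !inE => /and3P[-> ->]; case: (eqVneq z x) => //= _.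
by rewrite ltnNge ltnW // lt_rank // inD.
Qed.

(** * Numerical estimates and conclusion *)

Lemma exponent_bound d r : 0 < d -> 0 < r ->
  12 * d * (4 * d.*2 * d.*2.+1 ^ 2 * (16 ^ (d * (4 ^ r).*2.-2)) ^ 12)
    <= 2 ^ (d * 2 ^ (10 * r)).
Proof.
move=> d0 r0; set D := d * _.
have -> : (16 ^ D) ^ 12 = 2 ^ (48 * D).
  by rewrite -(expnM 2 4 D) -expnM; congr (2 ^ _); lia.
(* The left side is [12 * d] times the [K] of [exists_universal_color]; its factors polynomial in
   [d] are at most [2 ^ (13 * d)]. *)
apply: (@leq_trans (2 ^ (13 * d) * 2 ^ (48 * D))).
  rewrite mulnA leq_mul //.
  have le1 : d <= 2 ^ d by rewrite ltnW // ltn_expl.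
  have le2 : d.*2.+1 <= 2 ^ d.*2 by apply: ltn_expl.
  have le3 : 96 <= 2 ^ (7 * d).
    by apply: (@leq_trans (2 ^ 7)) => //; rewrite leq_exp2l // leq_pmulr.
  have -> : 13 * d = 7 * d + (d + d) + (d.*2 + d.*2) by lia.
  rewrite (expnD _ (_ + _)) (expnD _ (7 * d)) (expnD 2 d d) (expnD 2 d.*2 d.*2).
  have -> : 12 * d * (4 * d.*2 * d.*2.+1 ^ 2) = 96 * (d * d) * (d.*2.+1 * d.*2.+1) by nia.
  by apply: leq_mul (leq_mul le3 (leq_mul le1 le1)) (leq_mul le2 le2).
rewrite -expnD leq_exp2l // /D mulnCA [13 * d]mulnC -mulnDr leq_mul //.
(* With [x = 4 ^ r >= 4], it remains that [13 + 48 * (2 * x - 2) <= 256 * x <= x ^ 5]; the fifth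
   power gives the constant 10. *)
have x4 : 4 <= 4 ^ r by rewrite -{1}(expn1 4) leq_exp2l.
have -> : 2 ^ (10 * r) = (4 ^ r) ^ 5.
  by rewrite -!(expnM 2 2) -!expnM; congr (2 ^ _); lia.
move: (4 ^ r) x4 => x x4; rewrite !expnS expn0 muln1.
have : 4 * 4 <= x * x by apply: leq_mul.
move: (x * x) => y y16; have := leq_mul x4 (leq_mul x4 y16).
move: (x * (x * y)) => z z256; apply: leq_trans (leq_mul (leqnn x) z256); lia.
Qed.

Lemma expnMn_leq (a n d : nat) : 0 < d -> 0 < n -> n * a ^ d <= (n * a) ^ d.
Proof. by move=> d0 n0; rewrite expnMn leq_mul // -{1}(expn1 n) leq_pexp2l. Qed.

Lemma fact_leq_exp k : k`! <= k.+1 ^ k.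
Proof.
elim: k => // k IH; rewrite factS expnS leq_mul //.
by apply: leq_trans IH _; apply: leq_exp2rW.
Qed.

Section Main.
Variables (V : finType) (chi : {set complete_graph V} -> bool).

Let e b : rel V := color_adj chi b.

Lemma color_adj_total x y : x != y -> e true x y || e false x y.
Proof.
by move=> xy; rewrite /e /color_adj /= /complete_adj xy /=; case: (chi _).
Qed.

Lemma exists_universal_color (d r n : nat) :
  0 < d -> 0 < r -> 0 < n -> 2 ^ (d * 2 ^ (10 * r)) * n <= #|V| ->
  exists b, universal (color_graph chi b) (degenerate_colorable_family d r n).
Proof.
move=> d0 r0 n0 leV; pose k := d.*2; pose D := d * (4 ^ r).*2.-2.
(* Since [k = 2 * d], the square in [K] becomes [k.+1 ^ k] in [K ^ d], so [K ^ d] dominates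
   [4 * k ^ d * k.+1 ^ k * beta] for [beta = L ^ (12 * d)]. *)
pose L := 16 ^ D; pose K := 4 * k * k.+1 ^ 2 * L ^ 12.
have leK : 12 * d * n * K <= #|V|.
  apply: leq_trans leV; rewrite mulnAC leq_mul // /K; exact: exponent_bound.
have L0 : 0 < L by rewrite expn_gt0.
have L12 : L <= L ^ 12 by rewrite -{1}(expn1 L) leq_pexp2l.
have K0 : 0 < K by rewrite /K !muln_gt0 !expn_gt0 double_gt0 d0.
have V0 : 0 < #|V| by apply: leq_trans leK; rewrite !(muln_gt0, expn_gt0, double_gt0) d0 n0.
have e_sym b : symmetric (e b) by exact: (@color_adj_sym (complete_graph V) chi b).
have e_irr b : irreflexive (e b) by exact: (@color_adj_irrefl (complete_graph V) chi b).
have V_large : 2 * L <= #|V|.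
  apply: leq_trans leK; apply: leq_mul.
    by apply: (@leq_trans (12 * 1 * 1)) => //; rewrite !leq_mul.
  by apply: leq_trans L12 _; rewrite leq_pmull // !muln_gt0 double_gt0 d0.
have [b [Vs [Ms [VsMs sumMs]]]] :=
  two_color_structure e_sym color_adj_total d0 r0 V_large.
exists b => F [degF [col colF] cardF].
have [rank [inj_rank le_d]] := degenerate_rank degF.
pose W u := [set w : F | adj u w & rank w < rank u].
have KdE : 4 * k ^ d * k.+1 ^ k * L ^ (12 * d) <= K ^ d.
  have -> : K ^ d = 4 ^ d * k ^ d * k.+1 ^ (2 * d) * L ^ (12 * d).
    by rewrite !(expnMn, expnM).
  rewrite mul2n; do 3! apply: leq_mul => //.
  by rewrite -{1}(expn1 4) leq_pexp2l.
(* The left side is at most [n * K ^ d], since [k.+1 ^ k] absorbs the factorial; the factor 12 makes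
   the inequality strict. *)
have ltV : 4 * n * L ^ (12 * d) * k`! < #|V| ^ d.
  apply: (@leq_trans ((12 * d * n * K) ^ d)); last exact: leq_exp2rW.
  have nK0 : 0 < n * K ^ d by rewrite !(muln_gt0, expn_gt0, double_gt0) d0 n0.
  have le1 : 4 * n * L ^ (12 * d) * k`! <= n * K ^ d.
    apply: leq_trans (leq_mul (leqnn n) KdE); rewrite [4 * n]mulnC -!mulnA leq_mul // leq_mul //.
    rewrite mulnC mulnA leq_mul //; apply: leq_trans (fact_leq_exp k) _.
    by rewrite leq_pmull // expn_gt0 double_gt0 d0.
  apply: leq_ltn_trans le1 _; apply: (@leq_trans (12 * (n * K ^ d))).
    by rewrite -{1}[n * _]mul1n ltn_pmul2r.
  have -> : 12 * d * n * K = 12 * (d * n * K) by rewrite !mulnA.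
  apply: (@leq_trans (12 * (d * n * K) ^ d)).
    rewrite leq_mul // -mulnA; apply: leq_trans (expnMn_leq K d0 n0) _.
    by apply: leq_exp2rW; rewrite leq_pmull.
  exact: expnMn_leq.
have KR1 : (1 <= K%:R :> rat)%R by rewrite ler1n.
have VR1 : (1 <= #|V|%:R :> rat)%R by rewrite ler1n.
have le_K : (4 * k%:R ^+ d * k.+1%:R ^+ k * (L ^ (12 * d))%:R <= K%:R ^+ d :> rat)%R.
  by rewrite -!natrX -!natrM ler_nat.
have le_V : (12 * d%:R * n%:R * K%:R <= #|V|%:R :> rat)%R.
  by rewrite -!natrM ler_nat.
have lt_V : (4 * n%:R * (L ^ (12 * d))%:R * k`!%:R < #|V|%:R ^+ d :> rat)%R.
  by rewrite -!natrX -!natrM ltr_nat.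
have rankW u w : w \in W u -> rank w < rank u by rewrite inE => /andP[].
have VsMsW u w : w \in W u -> Vs (col w) \subset Ms (col u).
  by rewrite inE => /andP[uw _]; apply: VsMs; apply: colF.
have sumW u m : m <= d -> (tsum (Ms (col u)) m (fun l =>
    (#|V|%:R / #|Vs (col u) :&: common_nbrs (e b) l|.+1%:R) ^+ k)
    <= #|V|%:R ^+ m * (L ^ (12 * d))%:R)%R.
  by rewrite /L !natrX; apply: sumMs.
have [f [inj_f f_adj]] := degenerate_embedding (e_irr b) rankW le_d d0 cardF VsMsW sumW
  KR1 le_K le_V lt_V VR1 (ler0n _ _).
exists f; split=> // x y xy; have : rank x != rank y.
  by apply: contraTneq xy => /inj_rank ->; rewrite adj_irrefl.
rewrite neq_ltn => /orP[lt_xy|lt_yx]; last by apply: f_adj; rewrite inE xy.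
by rewrite adj_sym; apply: f_adj; rewrite inE adj_sym xy.
Qed.

End Main.

Theorem theorem1p1 :
  exists c : nat, forall d r n : nat,
    2 ^ (d ^ 2 * 2 ^ (c * r)) <= n ->
    forall V : finType, 2 ^ (d * 2 ^ (c * r)) * n <= #|V| ->
    forall chi : {set complete_graph V} -> bool,
    exists b : bool,
      universal (color_graph chi b) (degenerate_colorable_family d r n).
Proof.
exists 10 => d r n le_n V leV chi.
have n0 : 0 < n by apply: leq_trans le_n; rewrite expn_gt0.
have [r_eq0|r0] := posnP r.
  exists true => F [_ [col _] _]; rewrite r_eq0 in col.
  have F_empty (x : F) : False by case: (col x).
  by exists (fun x => False_rect _ (F_empty x)); split=> x; case: (F_empty x).
(* For [d = 0] any injection works: [F] has no edge, as both ends of an edge would have positive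
   degree in the pair they form. *)
have [d_eq0|d0] := posnP d; last exact: exists_universal_color leV.
exists true => F [degF _ cardF]; rewrite d_eq0 mul0n mul1n in degF leV.
have FV : #|F| <= #|V| := leq_trans cardF leV.
exists (fun x => enum_val (widen_ord FV (enum_rank x))); split=> [x y|x y xy].
  by move=> /enum_val_inj/(congr1 val)/= /val_inj/enum_rank_inj.
have [|z zS] := degenerate_low_degree (S := [set x; y]) degF.
  by apply/set0Pn; exists x; rewrite !inE eqxx.
rewrite leqn0 cards_eq0 => /eqP/setP eq0.
case/set2P: zS eq0 => -> => [/(_ y)|/(_ x)]; rewrite !inE eqxx ?orbT.
  by rewrite xy.
by rewrite adj_sym xy.
Qed.
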